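(* Let $r\le n$, let $T'\in\mathbb{R}^n\otimes\mathbb{R}^n\otimes\mathbb{R}^n$ be a symmetric tensor with a decomposition $T'=\sum_{i=1}^r(u'_i)^{\otimes3}$, $u'_i\in\mathbb{R}^n$, and let $U'\in\mathbb{R}^{r\times n}$ be the matrix with rows $u'_i$. Let $\sigma>0$, let $U\in\mathbb{R}^{r\times n}$ have independent entries $U_{ij}\sim\mathcal N(U'_{ij},\sigma^2)$, and let $T=\sum_{i=1}^ru_i^{\otimes3}$ where $u_1,\dots,u_r$ are the rows of $U$. Then $$\kappa(T)\le 98\sigma^2n^3+2n\|U'\|_F^2+\frac{e^2n^4}{\sigma^2}$$ with probability at least $1-\big(\frac1{\sqrt n}+e^{-2n/\pi^2}\big)$.
   Context: $\kappa(T)=\|U\|_F^2+\|U^\dagger\|_F^2$, where $U$ is the matrix whose rows are the vectors $u_i$ of the decomposition $T=\sum u_i^{\otimes3}$ and $U^\dagger$ is its Moore–Penrose pseudoinverse. *)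

(* Defs.v *)
From HB Require Import structures.
From mathcomp Require Import all_boot all_order all_algebra.
From mathcomp Require Import all_classical all_reals all_analysis.
Set Implicit Arguments. Unset Strict Implicit. Unset Printing Implicit Defensive.
Import Order.TTheory GRing.Theory Num.Theory.
Local Open Scope classical_set_scope.
Local Open Scope ring_scope.

Definition frob2 {R : realType} {m n : nat} (A : 'M[R]_(m, n)) : R :=
  \sum_(i < m) \sum_(j < n) A i j ^+ 2.

Definition penrose {R : realType} {m n : nat}
    (A : 'M[R]_(m, n)) (X : 'M[R]_(n, m)) : bool :=
  [&& A *m X *m A == A, X *m A *m X == X,
      (A *m X)^T == A *m X & (X *m A)^T == X *m A].

(* Moore-Penrose pseudoinverse: the (unique, always existing) solution of the
   Penrose equations.  The fallback branch is never used mathematically. *)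
Definition mp_pinv {R : realType} {m n : nat} (A : 'M[R]_(m, n)) : 'M[R]_(n, m) :=
  match boolp.pselect (exists X, penrose A X) with
  | left h => xchoose h
  | right _ => 0
  end.

(* kappa(T) = ||U||_F^2 + ||U^+||_F^2 where U has rows u_i of T = sum u_i^{(x)3}. *)
Definition kappa {R : realType} {r n : nat} (U : 'M[R]_(r, n)) : R :=
  frob2 U + frob2 (mp_pinv U).

Definition tensor3 {R : realType} {r n : nat} (U : 'M[R]_(r, n))
    (a b c : 'I_n) : R :=
  \sum_(i < r) U i a * U i b * U i c.

(* Mutual independence of a finite family of real random variables:
   product rule for every family of Borel sets (taking B i = setT for the
   indices not involved gives the rule for every subfamily). *)
Definition mutually_independent {d : measure_display} {Omega : measurableType d}
    {R : realType} (P : probability Omega R) {I : finType} (X : I -> Omega -> R) : Prop :=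
  forall B : I -> set R, (forall i, measurable (B i)) ->
    P (\bigcap_(i in [set: I]) (X i @^-1` B i)) = (\prod_(i : I) P (X i @^-1` B i))%E.

(* Main.v *)
(* The leading r x r block A of U yields a right inverse of U, and the Moore-Penrose
   inverse has the least Frobenius norm among the right inverses, so
   ||U^+||_F^2 <= ||A^-1||_F^2 = sum_i |w_i|^2 / det(A)^2, where w_i is the vector
   of cofactors along row i of A.  As det(A) = <A_i, w_i> and w_i does not depend
   on A_i, conditionally on the other rows det(A) is Gaussian with standard
   deviation sigma |w_i|.  Markov's inequality applied to
   exp(- det(A)^2 / (2 delta^2 |w_i|^2)), whose mean is computed by integrating out
   the entries of A_i one at a time, gives
   P(|det(A)| <= delta |w_i|) <= sqrt(e) delta / sigma; that w_i <> 0 almost surely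
   follows by induction on the size of the minors.  Taking
   delta = sigma / (e n^(3/2)) and summing over i costs at most 1 / sqrt(e n).
   For ||U||_F^2 <= 2 ||U'||_F^2 + 2 ||U - U'||_F^2, Markov's inequality for the
   second moment costs at most 6 / (49 n), and 1 / sqrt(e n) + 6 / (49 n) <= 1 / sqrt n.
   The measurability of kappa comes from U^+ = lim U^T (U U^T + eps)^-1. *)
Require Import Defs.
From HB Require Import structures.
From mathcomp Require Import all_boot all_order all_algebra.
From mathcomp Require Import ring lra.
From mathcomp Require Import all_classical all_reals all_analysis.
From mathcomp Require Import measurable_realfun.
Set Implicit Arguments. Unset Strict Implicit. Unset Printing Implicit Defensive.
Import Order.TTheory GRing.Theory Num.Theory.
Import numFieldNormedType.Exports.
Local Open Scope classical_set_scope.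
Local Open Scope ring_scope.

(** * Frobenius norm and pseudoinverse *)

Lemma frob2_ge0 (R : realType) m n (A : 'M[R]_(m, n)) : 0 <= frob2 A.
Proof. by apply: sumr_ge0 => i _; apply: sumr_ge0 => j _; exact: sqr_ge0. Qed.

Lemma sqr_le_frob2 (R : realType) m n (A : 'M[R]_(m, n)) i j :
  A i j ^+ 2 <= frob2 A.
Proof.
rewrite /frob2 (bigD1 i)//= (bigD1 j)//= -addrA lerDl addr_ge0//.
  by apply: sumr_ge0 => k _; exact: sqr_ge0.
by apply: sumr_ge0 => k _; apply: sumr_ge0 => l _; exact: sqr_ge0.
Qed.

Lemma frob2_eq0 (R : realType) m n (A : 'M[R]_(m, n)) : frob2 A <= 0 -> A = 0.
Proof.
move=> A0; apply/matrixP => i j; rewrite mxE; apply/eqP.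
by rewrite -sqrf_eq0 eq_le sqr_ge0 (le_trans (sqr_le_frob2 A i j)).
Qed.

Lemma mxtrace_trmx_mul (R : realType) m n (A B : 'M[R]_(m, n)) :
  \tr (A^T *m B) = \sum_(i < m) \sum_(j < n) A i j * B i j.
Proof.
rewrite /mxtrace exchange_big; apply: eq_bigr => j _; rewrite mxE.
by apply: eq_bigr => i _; rewrite mxE.
Qed.

Lemma frob2_tr (R : realType) m n (A : 'M[R]_(m, n)) : frob2 A = \tr (A^T *m A).
Proof. by rewrite mxtrace_trmx_mul. Qed.

Lemma frob2_trmx (R : realType) m n (A : 'M[R]_(m, n)) : frob2 A^T = frob2 A.
Proof. by rewrite !frob2_tr trmxK mxtrace_mulC. Qed.

Lemma frob2D (R : realType) m n (A B : 'M[R]_(m, n)) :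
  frob2 (A + B) = frob2 A + frob2 B + 2 * \tr (A^T *m B).
Proof.
rewrite /frob2 mxtrace_trmx_mul mulr_sumr -!big_split; apply: eq_bigr => i _ /=.
rewrite mulr_sumr -!big_split; apply: eq_bigr => j _ /=.
by rewrite mxE; ring.
Qed.

(** [X *m U] is an orthogonal projection and [X = X *m U *m Z], so [X] is orthogonal to [Z - X] and
    Pythagoras applies. *)
Lemma penrose_frob2_min (R : realType) m n (U : 'M[R]_(m, n)) X Z :
  penrose U X -> U *m Z = 1%:M -> frob2 X <= frob2 Z.
Proof.
case/and4P => _ /eqP XUX _ /eqP sXU UZ.
have XE : X = X *m U *m Z by rewrite -mulmxA UZ mulmx1.
have -> : Z = X + (Z - X) by rewrite addrC subrK.
have -> : frob2 (X + (Z - X)) = frob2 X + frob2 (Z - X).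
  rewrite frob2D [X in X^T]XE trmx_mul sXU mulmxBr -[_ *m X]mulmxA XUX.
  by rewrite -mulmxA -XE subrr raddf0 mulr0 addr0.
by rewrite lerDl frob2_ge0.
Qed.

Lemma frob2_invmx (R : realType) n (A : 'M[R]_n) : A \in unitmx ->
  frob2 (invmx A) = \sum_i (\sum_j cofactor A i j ^+ 2) / \det A ^+ 2.
Proof.
move=> uA; rewrite /frob2 exchange_big; apply: eq_bigr => i _.
rewrite mulr_suml; apply: eq_bigr => j _.
by rewrite /invmx uA !mxE exprMn mulrC exprVn.
Qed.

(** If a row vector [u] kills [B *m B^T], the squared norm of [u *m B] is zero; hence [u *m B = 0],
    and [u = 0] by freeness of the rows. *)
Lemma gram_unitmx (R : realType) m n (B : 'M[R]_(m, n)) :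
  row_free B -> B *m B^T \in unitmx.
Proof.
move=> fB; rewrite -row_free_unit -kermx_eq0; apply/eqP.
apply/row_matrixP => i; rewrite row0.
set u := row i _.
have uBB : u *m (B *m B^T) = 0 by apply: sub_kermxP; exact: row_sub.
have uB : u *m B = 0.
  apply: frob2_eq0; rewrite -frob2_trmx frob2_tr trmxK trmx_mul !mulmxA -(mulmxA u).
  by rewrite uBB mul0mx raddf0.
by apply: (row_free_inj fB); rewrite mul0mx.
Qed.

(** The products of the candidate with [C *m B] collapse to the orthogonal projections onto the
    column space of [C] and the row space of [B]. Applied to a rank factorization, this shows that
    every matrix has a pseudoinverse. *)
Lemma penrose_full_rank_factor (R : realType) m k n
    (C : 'M[R]_(m, k)) (B : 'M[R]_(k, n)) : row_full C -> row_free B ->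
  penrose (C *m B) (B^T *m invmx (B *m B^T) *m invmx (C^T *m C) *m C^T).
Proof.
move=> fC fB; have uG := gram_unitmx fB.
have fCT : row_free C^T by move: fC; rewrite /row_full /row_free mxrank_tr.
have := gram_unitmx fCT; rewrite trmxK => uH.
set G := invmx (B *m B^T); set H := invmx (C^T *m C); set X := _ *m C^T.
have sG : G^T = G by rewrite /G trmx_inv trmx_mul trmxK.
have sH : H^T = H by rewrite /H trmx_inv trmx_mul trmxK.
have AX : C *m B *m X = C *m H *m C^T.
  by rewrite /X !mulmxA -(mulmxA C B) -(mulmxA C _ G) mulmxV// mulmx1.
have XA : X *m (C *m B) = B^T *m G *m B.
  by rewrite /X !mulmxA -(mulmxA _ C^T) -(mulmxA _ H) mulVmx// mulmx1.
apply/and4P; split; apply/eqP.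
- by rewrite AX !mulmxA -(mulmxA _ C^T) -(mulmxA _ H) mulVmx// mulmx1.
- rewrite XA /X !mulmxA -(mulmxA _ B) -(mulmxA (B^T *m G) (B *m B^T)).
  by rewrite mulmxV// mulmx1.
- by rewrite AX !trmx_mul sH trmxK mulmxA.
- by rewrite XA !trmx_mul sG trmxK mulmxA.
Qed.

Lemma penrose_exists (R : realType) m n (A : 'M[R]_(m, n)) :
  exists X, penrose A X.
Proof.
rewrite -(mulmx_base A); eexists.
exact: penrose_full_rank_factor (col_base_full A) (row_base_free A).
Qed.

Lemma mp_pinvP (R : realType) m n (A : 'M[R]_(m, n)) : penrose A (mp_pinv A).
Proof.
rewrite /mp_pinv; case: pselect => [h|]; first exact: xchooseP.
by move=> /(_ (penrose_exists A)).
Qed.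

(** * Measurability of the pseudoinverse *)

Lemma measurable_invr (R : realType) : measurable_fun [set: R] (fun x : R => x^-1).
Proof.
(* This reduces to the measurable function [powR]; both sides vanish at 0. *)
have -> : (fun x : R => x^-1) = (fun x : R => x * (x ^+ 2) `^ (- 1)).
  apply/funext => x; rewrite powR_inv1 ?sqr_ge0//.
  have [->|x0] := eqVneq x 0; first by rewrite invr0 mul0r.
  by field.
apply: measurable_funM => //.
rewrite -[X in measurable_fun _ X]/((@powR R ^~ (-1)) \o (fun x : R => x ^+ 2)).
by apply: measurableT_comp; [exact: measurable_powR|exact: measurable_funX].
Qed.

Lemma measurable_sqrtr (R : realType) : measurable_fun [set: R] (@Num.sqrt R).
Proof. by apply: continuous_measurable_fun; exact: sqrt_continuous. Qed.

Section measurable_mx.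
Context (d : measure_display) (T : measurableType d) (R : realType).

Definition measurable_mx m n (F : T -> 'M[R]_(m, n)) :=
  forall i j, measurable_fun [set: T] (fun w => F w i j).

Lemma measurable_trmx m n (F : T -> 'M[R]_(m, n)) :
  measurable_mx F -> measurable_mx (fun w => (F w)^T).
Proof. by move=> mF i j; under eq_fun do rewrite mxE; exact: mF. Qed.

Lemma measurable_mulmx m n p (F : T -> 'M[R]_(m, n)) (G : T -> 'M[R]_(n, p)) :
  measurable_mx F -> measurable_mx G -> measurable_mx (fun w => F w *m G w).
Proof.
move=> mF mG i j; under eq_fun do rewrite mxE.
by apply: measurable_sum => k; exact: measurable_funM.
Qed.

Lemma measurable_det n (F : T -> 'M[R]_n) :
  measurable_mx F -> measurable_fun [set: T] (fun w => \det (F w)).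
Proof.
move=> mF; apply: measurable_sum => s; apply: measurable_funM => //.
by apply: measurable_prod => i _; exact: mF.
Qed.

Lemma measurable_cofactor n (F : T -> 'M[R]_n) i j :
  measurable_mx F -> measurable_fun [set: T] (fun w => cofactor (F w) i j).
Proof.
move=> mF; apply: measurable_funM => //; apply: measurable_det => k l.
by under eq_fun do rewrite !mxE; exact: mF.
Qed.

Lemma measurable_invmx n (F : T -> 'M[R]_n) : (forall w, F w \in unitmx) ->
  measurable_mx F -> measurable_mx (fun w => invmx (F w)).
Proof.
move=> uF mF i j; under eq_fun do rewrite /invmx uF !mxE.
apply: measurable_funM; last exact: measurable_cofactor.
by apply: measurableT_comp (measurable_det mF); exact: measurable_invr.
Qed.

Lemma measurable_frob2 m n (F : T -> 'M[R]_(m, n)) :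
  measurable_mx F -> measurable_fun [set: T] (fun w => frob2 (F w)).
Proof.
move=> mF; apply: measurable_sum => i; apply: measurable_sum => j.
exact/measurable_funX/mF.
Qed.

End measurable_mx.

(** * Tikhonov regularization of the pseudoinverse *)

Section tikhonov.
Context (R : realType) (m n : nat).
Implicit Types (U : 'M[R]_(m, n)) (e : R).

(** For [e > 0] the inverse exists whatever the rank of [U], so the entries are measurable in [U];
    the pseudoinverse is the limit as [e] tends to 0. *)
Definition tikhonov U e : 'M[R]_(n, m) := U^T *m invmx (U *m U^T + e%:M).

(** Pairing a kernel vector [u] with its image gives [frob2 (u *m U) + e * frob2 u = 0], which
    forces [u = 0]. *)
Lemma tikhonov_unitmx U e : 0 < e -> U *m U^T + e%:M \in unitmx.
Proof.
move=> e0; rewrite -row_free_unit -kermx_eq0; apply/eqP.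
apply/row_matrixP => i; rewrite row0; set u := row i _.
have : u *m (U *m U^T + e%:M) = 0 by apply: sub_kermxP; exact: row_sub.
rewrite mulmxDr mul_mx_scalar => /(congr1 (fun v => \tr (v *m u^T))).
rewrite mulmxDl mul0mx raddf0 raddfD/= -scalemxAl linearZ/=.
have -> : u *m (U *m U^T) *m u^T = ((u *m U)^T)^T *m (u *m U)^T.
  by rewrite trmxK trmx_mul !mulmxA.
have -> : u *m u^T = (u^T)^T *m u^T by rewrite trmxK.
rewrite -!frob2_tr !frob2_trmx => /eqP.
rewrite paddr_eq0 ?frob2_ge0 ?mulr_ge0 ?frob2_ge0// 1?ltW//.
rewrite mulf_eq0 (gt_eqF e0)/= => /andP[_ /eqP u0].
by apply: frob2_eq0; rewrite u0.
Qed.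

(** Since [Y *m U *m U^T = U^T], one has [U^T + e *: Y = Y *m (U *m U^T + e%:M)]; multiplying by the
    inverse exhibits the error as a term of order [e]. *)
Lemma tikhonov_penrose U Y e : 0 < e -> penrose U Y ->
  Y = tikhonov U e + e *: (Y *m Y^T *m tikhonov U e).
Proof.
move=> e0 /and4P[/eqP UYU /eqP YUY /eqP sUY /eqP sYU].
have YS : Y *m U *m U^T = U^T by rewrite -sYU -trmx_mul mulmxA UYU.
have YYU : Y *m Y^T *m U^T = Y by rewrite -mulmxA -trmx_mul sUY mulmxA.
have uT := tikhonov_unitmx U e0.
rewrite /tikhonov; set I := invmx _.
rewrite (mulmxA (Y *m Y^T)) YYU scalemxAl -mulmxDl.
have -> : U^T + e *: Y = Y *m (U *m U^T + e%:M).
  by rewrite mulmxDr mulmxA YS mul_mx_scalar.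
by rewrite -mulmxA mulmxV// mulmx1.
Qed.

(** Expanding the square of the previous identity, the cross term is [2 * e] times the squared norm
    of [Y^T *m tikhonov U e], hence nonnegative. The bound is uniform in [e]. *)
Lemma frob2_tikhonov U Y e : 0 < e -> penrose U Y ->
  frob2 (tikhonov U e) <= frob2 Y.
Proof.
move=> e0 pY; rewrite [leRHS](congr1 frob2 (tikhonov_penrose e0 pY)) frob2D -addrA lerDl.
move: (tikhonov U e) => X; rewrite addr_ge0 ?frob2_ge0// mulr_ge0//.
rewrite -scalemxAr linearZ/= mulr_ge0 ?(ltW e0)//.
have -> : X^T *m (Y *m Y^T *m X) = (Y^T *m X)^T *m (Y^T *m X).
  by rewrite trmx_mul trmxK !mulmxA.
by rewrite -frob2_tr frob2_ge0.
Qed.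

Lemma cvg_tikhonov U Y i j : penrose U Y ->
  tikhonov U k.+1%:R^-1 i j @[k --> \oo] --> Y i j.
Proof.
move=> pY.
have e0 k : 0 < k.+1%:R^-1 :> R by rewrite invr_gt0.
(* Each entry [x] of the regularized inverse satisfies [|x| <= 1 + x ^+ 2 <= 1 + frob2 Y], so [C]
   bounds the error term without its factor [e]. *)
pose C := \sum_k `|(Y *m Y^T) i k| * (1 + frob2 Y).
have C0 : 0 <= C.
  by apply: sumr_ge0 => k _; rewrite mulr_ge0// addr_ge0// frob2_ge0.
have XC k : `|(Y *m Y^T *m tikhonov U k.+1%:R^-1) i j| <= C.
  rewrite mxE (le_trans (ler_norm_sum _ _ _))//; apply: ler_sum => l _.
  rewrite normrM ler_wpM2l//; set x := tikhonov _ _ _ _.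
  have xY : x ^+ 2 <= frob2 Y.
    exact: le_trans (sqr_le_frob2 _ _ _) (frob2_tikhonov (e0 k) pY).
  move: xY; rewrite -real_normK ?num_real//.
  have := frob2_ge0 Y; move: (frob2 Y) => y y0 xy.
  by have := sqr_ge0 (`|x| - 1); rewrite sqrrB; lra.
have XY k : `|Y i j - tikhonov U k.+1%:R^-1 i j| <= k.+1%:R^-1 * C.
  rewrite [X in `|X - _|](_ : _ = tikhonov U k.+1%:R^-1 i j +
      k.+1%:R^-1 * (Y *m Y^T *m tikhonov U k.+1%:R^-1) i j); last first.
    by rewrite [in LHS](tikhonov_penrose (e0 k) pY) mxE [X in _ + X]mxE.
  by rewrite addrAC subrr add0r normrM ger0_norm// ler_wpM2l// ltW.
apply/cvgrPdist_le => e e_gt0.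
near=> k.
rewrite (le_trans (XY k))//.
rewrite mulrC ler_pdivrMr//.
rewrite mulrC -ler_pdivrMr//.
near: k.
exists (Num.truncn (C / e)) => // k /= hk.
apply: ltW; apply: (lt_le_trans (truncnS_gt _)).
by rewrite ler_nat ltnS.
Unshelve. all: by end_near. Qed.

End tikhonov.

Lemma measurable_mp_pinv (d : measure_display) (T : measurableType d) (R : realType)
    m n (F : T -> 'M[R]_(m, n)) :
  measurable_mx F -> measurable_mx (fun w => mp_pinv (F w)).
Proof.
move=> mF i j.
apply: (@measurable_fun_cvg _ _ _ _ (fun k w => tikhonov (F w) k.+1%:R^-1 i j)) => //.
  move=> k; apply: measurable_mulmx; first exact: measurable_trmx.
  apply: measurable_invmx => [w|i' j']; first exact: tikhonov_unitmx.
  under eq_fun do rewrite mxE; apply: measurable_funD => //.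
  by apply: measurable_mulmx => //; exact: measurable_trmx.
move=> w _; apply: cvg_tikhonov; exact: mp_pinvP.
Qed.

Lemma measurable_kappa (d : measure_display) (T : measurableType d) (R : realType)
    m n (F : T -> 'M[R]_(m, n)) :
  measurable_mx F -> measurable_fun [set: T] (fun w => kappa (F w)).
Proof.
move=> mF; apply: measurable_funD; apply: measurable_frob2 => //.
exact: measurable_mp_pinv.
Qed.

(** * Gaussian integrals *)

Section gaussian_integrals.
Context (R : realType).
Implicit Types (m s a b c q x : R).
Local Notation mu := (@lebesgue_measure R).

(** The Radon-Nikodym derivative of the normal law and [normal_pdf] have the same integral over
    every measurable set, so they agree almost everywhere. *)
Lemma ge0_integral_normal_prob m s (f : R -> \bar R) :
  measurable_fun [set: R] f -> (forall x, 0 <= f x)%E ->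
  (\int[normal_prob m s]_x f x = \int[mu]_x (f x * (normal_pdf m s x)%:E))%E.
Proof.
move=> mf f0.
have dom := normal_prob_dominates m s.
rewrite -(Radon_Nikodym_SigmaFinite.change_of_variables dom)//.
apply: ae_eq_integral => //.
- apply: emeasurable_funM => //.
  exact: measurable_int (Radon_Nikodym_SigmaFinite.f_integrable dom).
- apply: emeasurable_funM => //.
  by apply/measurable_EFinP; exact: measurable_normal_pdf.
- apply: ae_eqe_mul2l; apply: integral_ae_eq => //.
  + exact: Radon_Nikodym_SigmaFinite.f_integrable.
  + by apply/measurable_EFinP; exact: measurable_normal_pdf.
  + by move=> A _ mA; rewrite -Radon_Nikodym_SigmaFinite.f_integral.
Qed.

Lemma normal_peakE s : 0 < s -> normal_peak s = (s * Num.sqrt (pi *+ 2))^-1.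
Proof.
move=> s0; rewrite /normal_peak -mulrnAr sqrtrM ?sqr_ge0//.
by rewrite sqrtr_sqr ger0_norm// ltW.
Qed.

(** Up to the factor [c * sqrt (2 pi)], the centred Gaussian density of variance [q]. For
    [c = sqrt q > 0] it is [expR (- x ^+ 2 / (2 * q))]; for [q = 0] it is 0, as division by 0 yields
    0. *)
Definition gauss_kernel c q x := c / Num.sqrt q * expR (- x ^+ 2 / (2 * q)).

Lemma gauss_kernel_ge0 c q x : 0 <= c -> 0 <= gauss_kernel c q x.
Proof. by move=> c0; rewrite mulr_ge0 ?expR_ge0// mulr_ge0// invr_ge0 sqrtr_ge0. Qed.

Lemma gauss_kernel_normal_pdf c q m s a b x : 0 < q -> 0 < s ->
  gauss_kernel c q (a * x + b) * normal_pdf m s x =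
  gauss_kernel c (q + a ^+ 2 * s ^+ 2) (a * m + b) *
  normal_pdf ((q * m - a * b * s ^+ 2) / (q + a ^+ 2 * s ^+ 2))
             (Num.sqrt q * s / Num.sqrt (q + a ^+ 2 * s ^+ 2)) x.
Proof.
move=> q0 s0; set p := q + _.
have p0 : 0 < p by rewrite ltr_pwDl// mulr_ge0// sqr_ge0.
have sq0 : 0 < Num.sqrt q by rewrite sqrtr_gt0.
have sp0 : 0 < Num.sqrt p by rewrite sqrtr_gt0.
have t0 : 0 < Num.sqrt q * s / Num.sqrt p by rewrite !mulr_gt0// invr_gt0.
rewrite !normal_pdfE ?gt_eqF// /normal_fun !normal_peakE//.
set w := Num.sqrt (pi *+ 2).
have w0 : 0 < w by rewrite sqrtr_gt0 mulrn_wgt0// pi_gt0.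
rewrite /gauss_kernel.
(* Completing the square in [x]. *)
have E1 : - (a * x + b) ^+ 2 / (2 * q) + - (x - m) ^+ 2 / (s ^+ 2 *+ 2) =
  - (a * m + b) ^+ 2 / (2 * p) +
  - (x - (q * m - a * b * s ^+ 2) / p) ^+ 2 / ((Num.sqrt q * s / Num.sqrt p) ^+ 2 *+ 2).
  rewrite !exprMn exprVn !sqr_sqrtr ?(ltW q0) ?(ltW p0)// /p.
  by field; rewrite exprMn -/p !gt_eqF.
rewrite mulrACA -expRD E1 expRD [RHS]mulrACA; congr (_ * _).
by field; rewrite !gt_eqF.
Qed.

Lemma measurable_gauss_kernel c q a b :
  measurable_fun [set: R] (fun x => gauss_kernel c q (a * x + b)).
Proof.
apply: measurable_funM => //; apply: measurableT_comp => //.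
apply: measurable_funM => //; apply: measurableT_comp => //.
by apply: measurable_funX; apply: measurable_funD => //; exact: measurable_funM.
Qed.

(** Convolving Gaussians adds variances: by the factorization above, the integrand is a constant
    times a normal density. When [q = 0] the last hypothesis makes both sides 0. *)
Lemma integral_gauss_kernel c q m s a b : 0 <= c -> 0 <= q -> 0 < s ->
  (q = 0 -> c = 0) ->
  (\int[normal_prob m s]_x (gauss_kernel c q (a * x + b))%:E =
   (gauss_kernel c (q + a ^+ 2 * s ^+ 2) (a * m + b))%:E)%E.
Proof.
move=> c0 q0 s0 qc; have [q_eq0|q_neq0] := eqVneq q 0.
  rewrite (qc q_eq0) /gauss_kernel !mul0r.
  by under eq_integral do rewrite !mul0r; rewrite integral0.
have {}q0 : 0 < q by rewrite lt_neqAle eq_sym q_neq0.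
rewrite ge0_integral_normal_prob//; last 2 first.
- by apply/measurable_EFinP; exact: measurable_gauss_kernel.
- by move=> x; rewrite lee_fin gauss_kernel_ge0.
under eq_integral do rewrite -EFinM gauss_kernel_normal_pdf// EFinM.
rewrite ge0_integralZl//.
- by rewrite integral_normal_pdf mule1.
- by apply/measurable_EFinP; exact: measurable_normal_pdf.
- by move=> x _; rewrite lee_fin normal_pdf_ge0.
- by rewrite lee_fin gauss_kernel_ge0.
Qed.

Lemma normal_prob_set1 m s x : normal_prob m s [set x] = 0%E.
Proof.
have /null_content_dominatesP dom := normal_prob_dominates m s.
by apply: dom => //; exact: lebesgue_measure_set1.
Qed.

(* The true value is [s ^+ 2]; the cruder constant comes from [y <= expR y]
   with [y = ((x - m) / (2 * s)) ^+ 2], which keeps the integrand Gaussian. *)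
Lemma integral_normal_prob_sqr_le m s : 0 < s ->
  (\int[normal_prob m s]_x ((x - m) ^+ 2)%:E <= (6 * s ^+ 2)%:E)%E.
Proof.
move=> s0.
have msq : measurable_fun [set: R] (fun x : R => (x - m) ^+ 2).
  by apply: measurable_funX; exact: measurable_funB.
rewrite ge0_integral_normal_prob//; last 2 first.
- exact/measurable_EFinP.
- by move=> x; rewrite lee_fin sqr_ge0.
have s2 : 0 < Num.sqrt 2 * s by rewrite mulr_gt0// sqrtr_gt0.
have C0 : 0 <= 4 * s ^+ 2 * Num.sqrt 2 by rewrite mulr_ge0 ?sqrtr_ge0// mulr_ge0 ?sqr_ge0//.
(* One factor [expR (- y)] absorbs [y]; the other is the Gaussian of deviation [sqrt 2 * s]. The
   constant combines [4 * s ^+ 2] from the definition of [y] with the ratio [sqrt 2] of the peaks,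
   and [sqrt 2 <= 3 / 2] then gives 6. *)
apply: (@le_trans _ _ (\int[mu]_x
    ((4 * s ^+ 2 * Num.sqrt 2)%:E * (normal_pdf m (Num.sqrt 2 * s) x)%:E))%E).
  apply: ge0_le_integral => //.
  - by move=> x _; rewrite -EFinM lee_fin mulr_ge0 ?sqr_ge0 ?normal_pdf_ge0.
  - by apply/measurable_EFinP/measurable_funM => //; exact: measurable_normal_pdf.
  - by apply/measurable_EFinP/measurable_funM => //; exact: measurable_normal_pdf.
  - move=> x _; rewrite -!EFinM lee_fin !normal_pdfE ?gt_eqF// !normal_peakE//.
    rewrite /normal_fun; set w := Num.sqrt (pi *+ 2).
    have w0 : 0 < w by rewrite sqrtr_gt0 mulrn_wgt0// pi_gt0.
    have q0 : 0 < Num.sqrt 2 :> R by rewrite sqrtr_gt0.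
    set y := (x - m) ^+ 2 / (4 * s ^+ 2).
    have -> : (x - m) ^+ 2 = 4 * s ^+ 2 * y by rewrite /y; field; rewrite gt_eqF.
    have -> : - (4 * s ^+ 2 * y) / (s ^+ 2 *+ 2) = - y + - y.
      by field; rewrite gt_eqF.
    have -> : - (4 * s ^+ 2 * y) / ((Num.sqrt 2 * s) ^+ 2 *+ 2) = - y.
      by rewrite exprMn sqr_sqrtr//; field; rewrite gt_eqF.
    have -> : 4 * s ^+ 2 * Num.sqrt 2 * ((Num.sqrt 2 * s * w)^-1 * expR (- y)) =
       4 * s ^+ 2 * (s * w)^-1 * expR (- y).
      by field; rewrite !gt_eqF.
    rewrite expRD [leLHS](_ : _ =
        4 * s ^+ 2 * (s * w)^-1 * expR (- y) * (y * expR (- y))); last by ring.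
    rewrite ler_piMr//.
      rewrite mulr_ge0 ?expR_ge0// mulr_ge0 ?invr_ge0 ?(ltW (mulr_gt0 s0 w0))//.
      by rewrite mulr_ge0 ?sqr_ge0.
    rewrite expRN ler_pdivrMr ?expR_gt0// mul1r.
    by apply: le_trans (expR_ge1Dx _); rewrite lerDr.
rewrite ge0_integralZl//.
- rewrite integral_normal_pdf mule1 lee_fin.
  have h : Num.sqrt 2 <= 3 / 2 :> R.
    rewrite -(ger0_norm (_ : 0 <= 3 / 2)) -?sqrtr_sqr ?ler_wsqrtr//; lra.
  have := sqr_ge0 s; nra.
- by apply/measurable_EFinP; exact: measurable_normal_pdf.
- by move=> x _; rewrite lee_fin normal_pdf_ge0.
Qed.

End gaussian_integrals.

(** * Resampling one of several independent variables *)

(** The law of the pair is the product of the laws, by uniqueness of product measures; Tonelli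
    concludes. *)
Lemma ge0_integral_indep_pair (R : realType) d d1 d2 (Omega : measurableType d)
    (P : probability Omega R) (T1 : measurableType d1) (T2 : measurableType d2)
    (X : {mfun Omega >-> T1}) (Y : {mfun Omega >-> T2})
    (h : T1 * T2 -> \bar R) :
  (forall A B, measurable A -> measurable B ->
    P (X @^-1` A `&` Y @^-1` B) = (P (X @^-1` A) * P (Y @^-1` B))%E) ->
  measurable_fun [set: T1 * T2] h -> (forall z, 0 <= h z)%E ->
  (\int[P]_w h (X w, Y w) = \int[P]_w \int[distribution P X]_x h (x, Y w))%E.
Proof.
move=> indep mh h0.
have mXY : measurable_fun [set: Omega] (fun w => (X w, Y w)).
  exact: measurable_fun_pair.
pose XY : {mfun Omega >-> (T1 * T2)%type} :=
  HB.pack (fun w => (X w, Y w)) (isMeasurableFun.Build _ _ _ _ _ mXY).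
transitivity (\int[distribution P XY]_z h z)%E.
  by rewrite ge0_integral_distribution.
rewrite (eq_measure_integral (distribution P X \x distribution P Y)%E); last first.
  move=> A mA _; apply/esym; apply: product_measure_unique => //.
rewrite fubini_tonelli2//.
rewrite ge0_integral_distribution//; first exact: measurable_fun_fubini_tonelli_G.
by move=> y; exact: integral_ge0.
Qed.

Section resampling.
Context (R : realType) d (Omega : measurableType d) (P : probability Omega R)
  (I : finType) (X : I -> Omega -> R).
Hypothesis mX : forall k, measurable_fun [set: Omega] (X k).
Hypothesis indX : mutually_independent P X.
Variable i : I.

(** A pi-system generating the sigma-algebra of the variables other than [X i]: the condition
    [B i = setT] leaves [X i] unconstrained. *)
Let G : set (set Omega) := [set A | exists B : I -> set R,
  [/\ forall k, measurable (B k), B i = setT &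
      A = \bigcap_(k in [set: I]) (X k @^-1` B k)]].

Let mXB k B : measurable B -> measurable (X k @^-1` B).
Proof. by move=> mB; rewrite -[X in measurable X]setTI; exact: mX. Qed.

Let G_measurable : G `<=` measurable.
Proof.
move=> A [B [mB _ ->]].
by apply: fin_bigcap_measurable => // k _; exact: mXB.
Qed.

Let GT : G setT.
Proof.
exists (fun=> setT); split => //.
by apply/seteqP; split.
Qed.

Let GI : setI_closed G.
Proof.
move=> _ _ [A [mA Ai ->]] [B [mB Bi ->]].
exists (fun k => A k `&` B k); split => [k||]; first exact: measurableI.
  by rewrite Ai Bi setTI.
apply/seteqP; split => [w [wA wB] k _|w wAB].
  by split; [exact: wA|exact: wB].
by split => k _; have [] := wAB k Logic.I.
Qed.

Let sG_measurable : <<s G >> `<=` measurable.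
Proof. apply: smallest_sub => //; exact: sigma_algebra_measurable. Qed.

(** As functions of [E], both sides are finite measures that agree on the pi-system [G], hence on
    the sigma-algebra it generates. *)
Let indep_G D E : measurable D -> <<s G >> E ->
  P (X i @^-1` D `&` E) = (P (X i @^-1` D) * P E)%E.
Proof.
move=> mD GE; set Di := X i @^-1` D.
have mDi : measurable Di by exact: mXB.
have r0 : 0 <= fine (P Di) by rewrite fine_ge0.
pose r := NngNum r0.
have rE : r%:num%:E = P Di by rewrite /= fineK// fin_num_measure.
rewrite setIC -/(mrestr P mDi E) -rE -/(mscale r P E).
apply: (g_sigma_algebra_measure_unique G G_measurable (fun=> setT) _ _
  (mrestr P mDi) (mscale r P)) => //.
- by rewrite bigcup_const//; exists 0%N.
- move=> A [B [mB Bi ->]].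
  transitivity (P (\bigcap_(k in [set: I]) (X k @^-1` B k) `&` Di)) => //.
  transitivity (P Di * P (\bigcap_(k in [set: I]) (X k @^-1` B k)))%E; last by rewrite -rE.
  (* The slot [i], left free by [B], receives [D], and the product rule applies to [B']. *)
  pose B' k := if k == i then D else B k.
  have mB' k : measurable (B' k) by rewrite /B'; case: ifP.
  have -> : \bigcap_(k in [set: I]) (X k @^-1` B k) `&` Di =
            \bigcap_(k in [set: I]) (X k @^-1` B' k).
    apply/seteqP; split => [w [wB wD] k _|w wB].
      by rewrite /B' /=; case: eqVneq => [->//|_]; exact: wB.
    split => [k _|]; last by have := wB i Logic.I; rewrite /B'/= eqxx.
    have := wB k Logic.I; rewrite /B'/=.
    by case: eqVneq => [->|//]; rewrite Bi.
  rewrite !indX// (bigD1 i)//= [in RHS](bigD1 i)//= Bi preimage_setT probability_setT mul1e.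
  rewrite /B' eqxx; congr (_ * _)%E; apply: eq_bigr => k ki.
  by rewrite (negbTE ki).
- move=> _; rewrite -[ltLHS]/(P (setT `&` Di)) setTI.
  exact: le_lt_trans (probability_le1 P mDi) (ltry 1).
Qed.

Definition replace (y : I -> R) (x : R) : I -> R :=
  fun k => if k == i then x else y k.

(** Measurability is tested by composition with arbitrary measurable families, in place of a
    sigma-algebra on [I -> R]. *)
Definition measurable_coord d' (T : measurableType d') (f : (I -> R) -> T) :=
  forall d0 (S : measurableType d0) (Z : I -> S -> R),
    (forall k, measurable_fun [set: S] (Z k)) ->
    measurable_fun [set: S] (fun s => f (Z ^~ s)).

(** [X i] is independent of the other variables jointly, so it may be redrawn from its own law while
    they stay fixed. The map [psi] allows that law to be given on another space [S]. *)
Lemma ge0_integral_replace d' (S : measurableType d') (psi : S -> R)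
    (mu : {measure set S -> \bar R}) (f : (I -> R) -> \bar R) :
  measurable_fun [set: S] psi ->
  (forall B, measurable B -> P (X i @^-1` B) = mu (psi @^-1` B)) ->
  measurable_coord f -> (forall y, 0 <= f y)%E ->
  (\int[P]_w f (X ^~ w) = \int[P]_w \int[mu]_x f (replace (X ^~ w) (psi x)))%E.
Proof.
move=> mpsi Xmu mf f0.
(* [T] is [Omega] with the coarser sigma-algebra; the identity [Y] into [T] packs all the other
   variables into one random element independent of [X i]. *)
pose T := g_sigma_algebraType G.
have mid : measurable_fun [set: Omega] (fun w => w : T).
  by move=> _ A mA; rewrite setTI; exact: sG_measurable.
pose Y : {mfun Omega >-> T} :=
  HB.pack (fun w : Omega => w : T) (isMeasurableFun.Build _ _ _ _ _ mid).
pose Xi : {mfun Omega >-> R} :=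
  HB.pack (X i) (isMeasurableFun.Build _ _ _ _ _ (mX i)).
have mXT k : k != i -> measurable_fun [set: T] (X k).
  move=> ki _ B mB; rewrite setTI; apply: sub_sigma_algebra.
  exists (fun l => if l == k then B else setT); split.
  - by move=> l; case: ifP.
  - by rewrite eq_sym (negbTE ki).
  - apply/seteqP; split => [w wB l _|w wB]; first by rewrite /=; case: eqVneq => [->|].
    by have := wB k Logic.I; rewrite /= eqxx.
pose h (z : R * T) := f (replace (X ^~ z.2) z.1).
have mh : measurable_fun [set: R * T] h.
  apply: (mf _ _ (fun k (z : R * T) => replace (X ^~ z.2) z.1 k)) => k.
  rewrite /replace; case: eqVneq => ki; first exact: measurable_fst.
  by apply: measurableT_comp (mXT k ki) _; exact: measurable_snd.
transitivity (\int[P]_w h (Xi w, Y w))%E.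
  apply: eq_integral => w _; rewrite /h/=; congr f; apply/funext => k.
  by rewrite /replace; case: eqVneq => [->|].
rewrite ge0_integral_indep_pair//; last by move=> z; exact: f0.
apply: eq_integral => w _.
pose psi' : {mfun S >-> R} := HB.pack psi (isMeasurableFun.Build _ _ _ _ _ mpsi).
rewrite (eq_measure_integral (pushforward mu psi')); last by move=> B mB _; exact: Xmu.
rewrite ge0_integral_pushforward//; last by move=> x _; exact: f0.
apply: measurableT_comp mh _.
exact: measurable_fun_pair.
Qed.

End resampling.

(** * Small ball probability of a random linear form *)

(** Serves as [psi] in the resampling lemma when the law is [normal_prob], a measure on
    [measurableTypeR R]. *)
Lemma measurable_idTR (R : realType) :
  measurable_fun setT (idfun : measurableTypeR R -> R).
Proof. by move=> _ B mB; rewrite setTI; exact: mB. Qed.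

Section linear_form.
Context (R : realType) d (Omega : measurableType d) (P : probability Omega R)
  (I : finType) (X : I -> Omega -> R).
Hypothesis mX : forall k, measurable_fun [set: Omega] (X k).
Hypothesis indX : mutually_independent P X.
Context (p : nat) (e : 'I_p -> I) (m : 'I_p -> R) (s : R).
Hypothesis e_inj : injective e.
Hypothesis s0 : 0 < s.
Hypothesis Xe : forall j B, measurable B ->
  P (X (e j) @^-1` B) = normal_prob (m j) s B.
Context (W : 'I_p -> (I -> R) -> R) (delta : R).
Hypothesis mW : forall j, measurable_coord (W j).
Hypothesis WE : forall j l y x, W j (replace (e l) y x) = W j y.
Hypothesis delta0 : 0 < delta.

Definition weight2 y := \sum_j W j y ^+ 2.
Definition linear_form y := \sum_j W j y * y (e j).

(** State after integrating out the first [k] coordinates: in [l k] they are replaced by their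
    means, and [q k] adds their variances to the initial value [c ^+ 2]. *)
Let c y := delta * Num.sqrt (weight2 y).
Let q (k : nat) y := c y ^+ 2 + \sum_(j < p | (j < k)%N) W j y ^+ 2 * s ^+ 2.
Let l (k : nat) y := \sum_j W j y * (if (j < k)%N then m j else y (e j)).
Let g k y := (gauss_kernel (c y) (q k y) (l k y))%:E.

Let weight2_ge0 y : 0 <= weight2 y.
Proof. by apply: sumr_ge0 => j _; exact: sqr_ge0. Qed.

Let c_ge0 y : 0 <= c y.
Proof. by rewrite mulr_ge0 ?sqrtr_ge0// ltW. Qed.

Let q_ge0 k y : 0 <= q k y.
Proof.
rewrite addr_ge0 ?sqr_ge0// sumr_ge0// => j _.
by rewrite mulr_ge0 ?sqr_ge0.
Qed.

Lemma measurable_linear_form d0 (S : measurableType d0) (Z : I -> S -> R) :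
  (forall k, measurable_fun [set: S] (Z k)) ->
  measurable_fun [set: S] (fun w => linear_form (Z ^~ w)).
Proof.
move=> mZ; apply: measurable_sum => j; apply: measurable_funM; last exact: mZ.
exact: mW.
Qed.

Lemma measurable_weight2 d0 (S : measurableType d0) (Z : I -> S -> R) :
  (forall k, measurable_fun [set: S] (Z k)) ->
  measurable_fun [set: S] (fun w => weight2 (Z ^~ w)).
Proof. by move=> mZ; apply: measurable_sum => j; apply: measurable_funX; exact: mW. Qed.

Let mg k : measurable_coord (g k).
Proof.
move=> d0 S Z mZ; apply/measurable_EFinP.
have mc : measurable_fun [set: S] (fun w => c (Z ^~ w)).
  apply: measurable_funM => //.
  by apply: measurableT_comp (measurable_weight2 mZ); exact: measurable_sqrtr.
have mq : measurable_fun [set: S] (fun w => q k (Z ^~ w)).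
  apply: measurable_funD; first exact: measurable_funX.
  under eq_fun do rewrite big_mkcond.
  apply: measurable_sum => j; case: (j < k)%N => //.
  by apply: measurable_funM => //; apply: measurable_funX; exact: mW.
have ml : measurable_fun [set: S] (fun w => l k (Z ^~ w)).
  apply: measurable_sum => j; apply: measurable_funM; first exact: mW.
  by case: (j < k)%N => //; exact: mZ.
have mV (f : S -> R) : measurable_fun [set: S] f ->
    measurable_fun [set: S] (fun w => (f w)^-1).
  by move=> mf; apply: measurableT_comp mf; exact: measurable_invr.
apply: measurable_funM.
  apply: measurable_funM => //; apply: mV.
  by apply: measurableT_comp mq; exact: measurable_sqrtr.
apply: measurableT_comp => //.
apply: measurable_funM; last by apply: mV; exact: measurable_funM.
by apply: measurableT_comp => //; exact: measurable_funX.
Qed.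

Let g_ge0 k y : (0 <= g k y)%E.
Proof. by rewrite lee_fin gauss_kernel_ge0. Qed.

(* One Gaussian coordinate is integrated out, its variance moving into [q]. *)
Let integral_gS (k : 'I_p) :
  (\int[P]_w g k (X ^~ w) = \int[P]_w g k.+1 (X ^~ w))%E.
Proof.
rewrite (ge0_integral_replace mX indX (@measurable_idTR R) (@Xe k) (mg k) (g_ge0 k)).
apply: eq_integral => w _; set y := X ^~ w.
(* The part of the form that does not involve coordinate [k]; only [W k y * x] varies with the
   redrawn value. *)
pose b := \sum_(j | j != k) W j y * (if (j < k)%N then m j else y (e j)).
transitivity (\int[normal_prob (m k) s]_x
    (gauss_kernel (c y) (q k y) (W k y * x + b))%:E)%E.
  apply: eq_integral => x _; rewrite /g.
  have -> : c (replace (e k) y x) = c y.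
    by rewrite /c /weight2; under eq_bigr do rewrite WE.
  have -> : q k (replace (e k) y x) = q k y.
    rewrite /q /c /weight2; under eq_bigr do rewrite WE.
    by under [X in _ + X]eq_bigr do rewrite WE.
  rewrite /l (bigD1 k)//= ltnn WE /replace eqxx; congr (gauss_kernel _ _ (_ + _))%:E.
  apply: eq_bigr => j jk; rewrite WE; case: ifP => // _.
  by rewrite (inj_eq e_inj) (negbTE jk).
rewrite integral_gauss_kernel//; last first.
  rewrite /q => /eqP; rewrite paddr_eq0 ?sqr_ge0 ?sumr_ge0// => [/andP[]|j _].
    by rewrite sqrf_eq0 => /eqP.
  by rewrite mulr_ge0 ?sqr_ge0.
rewrite /g; congr (gauss_kernel _ _ _)%:E.
  rewrite /q -addrA; congr (_ + _).
  rewrite [RHS](bigD1 k) ?ltnSn//= addrC; congr (_ + _).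
  by apply: eq_bigl => j; rewrite ltnS ltn_neqAle andbC.
rewrite /l [RHS](bigD1 k)//= ltnSn; congr (_ + _).
apply: eq_bigr => j jk; rewrite ltnS [(j <= k)%N]leq_eqVlt.
by rewrite -[(_ == _ :> nat)]/(j == k) (negbTE jk).
Qed.

Let g0E y : g 0 y = (gauss_kernel (delta * Num.sqrt (weight2 y))
  ((delta * Num.sqrt (weight2 y)) ^+ 2) (linear_form y))%:E.
Proof. by rewrite /g /q big_pred0// addr0. Qed.

(** After all [p] steps the variance is [c ^+ 2 + s ^+ 2 * weight2]. Bounding the exponential by 1
    leaves [c / sqrt q], at most [delta / s]; if [q] vanishes this quotient is 0. *)
Lemma integral_linear_form_kernel :
  (\int[P]_w (gauss_kernel (delta * Num.sqrt (weight2 (X ^~ w)))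
      ((delta * Num.sqrt (weight2 (X ^~ w))) ^+ 2) (linear_form (X ^~ w)))%:E
   <= (delta / s)%:E)%E.
Proof.
have -> : (\int[P]_w (gauss_kernel (delta * Num.sqrt (weight2 (X ^~ w)))
      ((delta * Num.sqrt (weight2 (X ^~ w))) ^+ 2) (linear_form (X ^~ w)))%:E =
    \int[P]_w g 0 (X ^~ w))%E.
  by apply: eq_integral => w _; rewrite g0E.
have gp k : (k <= p)%N -> (\int[P]_w g 0 (X ^~ w) = \int[P]_w g k (X ^~ w))%E.
  elim: k => [_|k IH kp]; first by [].
  rewrite (IH (ltnW kp)).
  exact: (integral_gS (Ordinal kp)).
rewrite (gp p)//.
apply: (@le_trans _ _ (\int[P]_w (delta / s)%:E)%E); last first.
  by rewrite integral_cst//= probability_setT mule1.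
apply: ge0_le_integral => //.
- exact: mg.
- move=> w _; rewrite /= lee_fin; set y := X ^~ w.
  rewrite /gauss_kernel.
  apply: (@le_trans _ _ (c y / Num.sqrt (q p y))).
    have cq : 0 <= c y / Num.sqrt (q p y) by rewrite divr_ge0 ?sqrtr_ge0.
    apply: ler_piMr => //; rewrite -expR0 ler_expR mulNr oppr_le0 mulr_ge0 ?sqr_ge0//.
    by rewrite invr_ge0 mulr_ge0.
  have [q0|q0] := eqVneq (Num.sqrt (q p y)) 0.
    by rewrite q0 invr0 mulr0 divr_ge0 ?ltW.
  have sq0 : 0 < Num.sqrt (q p y) by rewrite lt_neqAle eq_sym q0 sqrtr_ge0.
  rewrite ler_pdivrMr// mulrAC ler_pdivlMr// /c -mulrA ler_pM2l//.
  have qE : q p y = c y ^+ 2 + weight2 y * s ^+ 2.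
    by rewrite /q /weight2 mulr_suml; congr (_ + _); apply: eq_bigl => j; rewrite ltn_ord.
  rewrite -(ger0_norm (ltW s0)) -sqrtr_sqr -sqrtrM// ler_wsqrtr// qE.
  by rewrite lerDr sqr_ge0.
Qed.

(** Markov's inequality for the kernel: on the event its prefactor is 1, because [weight2] is
    nonzero, and its exponent is at least [- 2^-1]. *)
Lemma small_ball_linear_form :
  (P [set w | (weight2 (X ^~ w) != 0) &&
      (linear_form (X ^~ w) ^+ 2 <= delta ^+ 2 * weight2 (X ^~ w))]%R
   <= (expR (2^-1) * (delta / s))%:E)%E.
Proof.
set E := [set w | _].
have mL := measurable_linear_form mX; have mN := measurable_weight2 mX.
have mE : measurable E.
  rewrite [E](_ : _ = (fun w => weight2 (X ^~ w)) @^-1` (~` [set 0]) `&`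
     (fun w => delta ^+ 2 * weight2 (X ^~ w) - linear_form (X ^~ w) ^+ 2)
       @^-1` `[0, +oo[%classic).
    apply: measurableI; rewrite -[X in measurable X]setTI.
      by apply: mN => //; exact: measurableC.
    have : measurable_fun [set: Omega]
        (fun w => delta ^+ 2 * weight2 (X ^~ w) - linear_form (X ^~ w) ^+ 2).
      by apply: measurable_funB; [exact: measurable_funM|exact: measurable_funX].
    by apply => //.
  apply/seteqP; split=> w /=; rewrite in_itv/= andbT subr_ge0.
    by case/andP => /eqP ? ?.
  by case=> /eqP ? ?; apply/andP.
have := integral_linear_form_kernel; set F := (X in (\int[P]_w X w <= _)%E -> _).
move=> FE.
have : ((expR (- 2^-1))%:E * P E <= \int[P]_w F w)%E.
  have -> : ((expR (- 2^-1))%:E * P E = \int[P]_w ((expR (- 2^-1))%:E * (\1_E w)%:E))%E.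
    rewrite ge0_integralZl ?lee_fin ?expR_ge0//; first by rewrite integral_indic// setIT.
    exact/measurable_EFinP.
  apply: ge0_le_integral => //.
  - by apply/measurable_EFinP/measurable_funM.
  - have := mg 0 mX; apply: eq_measurable_fun => w _.
    by rewrite g0E.
  - move=> w _; rewrite /F -EFinM lee_fin indicE.
    have [|wE] := boolP (w \in E); last first.
      rewrite mulr0; apply: gauss_kernel_ge0; exact: c_ge0.
    rewrite inE /E/= => /andP[N0 LN]; rewrite mulr1.
    have {}N0 : 0 < weight2 (X ^~ w) by rewrite lt_neqAle eq_sym N0 weight2_ge0.
    have c0 : 0 < delta * Num.sqrt (weight2 (X ^~ w)).
      by rewrite mulr_gt0// sqrtr_gt0.
    rewrite /gauss_kernel sqrtr_sqr ger0_norm ?(ltW c0)// divff ?gt_eqF// mul1r.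
    rewrite ler_expR mulNr lerN2 exprMn sqr_sqrtr ?(ltW N0)//.
    rewrite ler_pdivrMr; last by rewrite !mulr_gt0// exprn_gt0.
    by apply: (le_trans LN); rewrite mulrA mulVf// mul1r.
move=> /le_trans/(_ FE).
rewrite expRN => h; rewrite EFinM.
by rewrite -lee_pdivrMl ?expR_gt0.
Qed.

End linear_form.

(** * Determinants of Gaussian matrices *)

Section measurable_sets.
Context (R : realType) d (T : measurableType d).
Implicit Types f g : T -> R.

Lemma measurable_set_ler f g : measurable_fun [set: T] f ->
  measurable_fun [set: T] g -> measurable [set w | f w <= g w].
Proof.
move=> mf mg; rewrite [X in measurable X](_ : _ = (g \- f) @^-1` `[0, +oo[%classic).
  by rewrite -[X in measurable X]setTI; apply: measurable_funB.
by apply/seteqP; split=> w /=; rewrite in_itv/= andbT subr_ge0.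
Qed.

Lemma measurable_set_eqr0 f : measurable_fun [set: T] f ->
  measurable [set w | f w = 0].
Proof.
move=> mf; rewrite [X in measurable X](_ : _ = f @^-1` [set 0])//.
by rewrite -[X in measurable X]setTI; apply: mf.
Qed.

Lemma measure_bigsetU_le (mu : {measure set T -> \bar R}) n (A : 'I_n -> set T) :
  (forall i, measurable (A i)) ->
  (mu (\big[setU/set0]_(i < n) A i) <= \sum_(i < n) mu (A i))%E.
Proof.
move=> mA; suff [] : measurable (\big[setU/set0]_(i < n) A i) /\
  (mu (\big[setU/set0]_(i < n) A i) <= \sum_(i < n) mu (A i))%E by [].
apply: (big_rec2 (fun B y => measurable B /\ (mu B <= y)%E)).
  by rewrite measure0.
move=> i y B _ [mB By]; split; first exact: measurableU.
by apply: (le_trans (measureU2 _ _ _)) => //; exact: leeD2l.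
Qed.

End measurable_sets.

Section gaussian_matrix.
Context (R : realType) d (Omega : measurableType d) (P : probability Omega R)
  (I : finType) (X : I -> Omega -> R) (m : I -> R) (s : R).
Hypothesis mX : forall k, measurable_fun [set: Omega] (X k).
Hypothesis indX : mutually_independent P X.
Hypothesis s0 : 0 < s.
Hypothesis Xnormal : forall k B, measurable B ->
  P (X k @^-1` B) = normal_prob (m k) s B.

(** The indexing map [e] makes every minor again a matrix of this form, as the induction on the size
    requires. *)
Definition coord_mx k (e : 'I_k -> 'I_k -> I) (y : I -> R) : 'M[R]_k :=
  \matrix_(a, b) y (e a b).

Definition coord_inj k (e : 'I_k -> 'I_k -> I) :=
  forall a b a' b', e a b = e a' b' -> a = a' /\ b = b'.

Let measurable_coord_mx k (e : 'I_k -> 'I_k -> I) d0 (S : measurableType d0)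
    (Z : I -> S -> R) : (forall k, measurable_fun [set: S] (Z k)) ->
  measurable_mx (fun w => coord_mx e (Z ^~ w)).
Proof. by move=> mZ a b; under eq_fun do rewrite mxE; exact: mZ. Qed.

Let measurable_coord_det k (e : 'I_k -> 'I_k -> I) :
  measurable_coord (fun y => \det (coord_mx e y)).
Proof. by move=> d0 S Z mZ; apply/measurable_det/measurable_coord_mx. Qed.

Let measurable_coord_cofactor k (e : 'I_k -> 'I_k -> I) a b :
  measurable_coord (fun y => cofactor (coord_mx e y) a b).
Proof. by move=> d0 S Z mZ; apply/measurable_cofactor/measurable_coord_mx. Qed.

(** A cofactor along row [a] omits that row, and injectivity of [e] keeps the variable [e a c] out
    of the other rows. *)
Lemma cofactor_replace k (e : 'I_k -> 'I_k -> I) a b c y x : coord_inj e ->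
  cofactor (coord_mx e (replace (e a c) y x)) a b = cofactor (coord_mx e y) a b.
Proof.
move=> ei; rewrite /cofactor; congr (_ * \det _); apply/matrixP => i j.
rewrite !mxE /replace; case: eqVneq => // /ei[/eqP].
by rewrite eq_sym (negbTE (neq_lift _ _)).
Qed.

Lemma coord_mx_minor k (e : 'I_k.+1 -> 'I_k.+1 -> I) a b y :
  row' a (col' b (coord_mx e y)) = coord_mx (fun i j => e (lift a i) (lift b j)) y.
Proof. by apply/matrixP => i j; rewrite !mxE. Qed.

Lemma coord_inj_minor k (e : 'I_k.+1 -> 'I_k.+1 -> I) a b : coord_inj e ->
  coord_inj (fun i j => e (lift a i) (lift b j)).
Proof. by move=> ei i j i' j' /ei[/lift_inj -> /lift_inj ->]. Qed.

Lemma measurable_det_eq0 k (e : 'I_k -> 'I_k -> I) :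
  measurable [set w | \det (coord_mx e (X ^~ w)) = 0].
Proof. by apply: measurable_set_eqr0; exact: measurable_coord_det. Qed.

Lemma measurable_cofactor_eq0 k (e : 'I_k -> 'I_k -> I) a b :
  measurable [set w | cofactor (coord_mx e (X ^~ w)) a b = 0].
Proof. by apply: measurable_set_eqr0; exact: measurable_coord_cofactor. Qed.

Lemma cofactor_eq0 k (e : 'I_k.+1 -> 'I_k.+1 -> I) a b :
  [set w | cofactor (coord_mx e (X ^~ w)) a b = 0] =
  [set w | \det (coord_mx (fun i j => e (lift a i) (lift b j)) (X ^~ w)) = 0].
Proof.
apply/seteqP; split => w /=; rewrite /cofactor coord_mx_minor; last by move=> ->; rewrite mulr0.
by move/eqP; rewrite mulf_eq0 signr_eq0 => /eqP.
Qed.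

(* Conditionally on the other entries, the determinant is an affine function of
   its top left entry, whose slope is a minor of smaller size. *)
Lemma det_eq0_negligible k (e : 'I_k -> 'I_k -> I) : coord_inj e ->
  P [set w | \det (coord_mx e (X ^~ w)) = 0] = 0%E.
Proof.
elim: k e => [|k IH] e ei.
  rewrite [X in P X](_ : _ = set0) ?measure0//.
  by apply/seteqP; split => w //=; rewrite det_mx00 => /eqP; rewrite oner_eq0.
set D := [set w | _]; have mD : measurable D by exact: measurable_det_eq0.
pose C := [set w | cofactor (coord_mx e (X ^~ w)) ord0 ord0 = 0].
have mC : measurable C by exact: measurable_cofactor_eq0.
have PC : P C = 0%E by rewrite /C cofactor_eq0; apply: IH; exact: coord_inj_minor.
(* The indicator of [D] minus [C], written as a function of the coordinates so that the top left
   entry can be redrawn. *)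
pose f y := (\1_[set (0:R)] (\det (coord_mx e y)) *
             \1_(~` [set (0:R)]) (cofactor (coord_mx e y) ord0 ord0) : R)%:E.
have mf : measurable_coord f.
  move=> d0 S Z mZ; apply/measurable_EFinP/measurable_funM.
    apply: measurableT_comp; last exact: measurable_coord_det.
    exact: measurable_indic.
  apply: measurableT_comp; last exact: measurable_coord_cofactor.
  by apply: measurable_indic; exact: measurableC.
have f0 y : (0 <= f y)%E by rewrite lee_fin mulr_ge0// indicE.
have PDC : P (D `&` ~` C) = 0%E.
  have -> : P (D `&` ~` C) = (\int[P]_w f (X ^~ w))%E.
    rewrite -[in LHS](setIT (D `&` ~` C)) -integral_indic//; last first.
      by apply: measurableI => //; exact: measurableC.
    apply: eq_integral => w _; rewrite /f; congr _%:E.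
    by rewrite !indicE in_setI -mulnb natrM.
  rewrite (ge0_integral_replace mX indX (@measurable_idTR R)
    (@Xnormal (e ord0 ord0)) mf f0).
  apply: integral0_eq => w _; set y := X ^~ w.
  pose c := cofactor (coord_mx e y) ord0 ord0.
  pose b := \sum_(j | j != ord0) y (e ord0 j) * cofactor (coord_mx e y) ord0 j.
  have fE x : f (replace (e ord0 ord0) y x) =
      (\1_[set (0:R)] (x * c + b) * \1_(~` [set (0:R)]) c)%:E.
    rewrite /f cofactor_replace// (expand_det_row _ ord0) (bigD1 ord0)//=.
    rewrite cofactor_replace// mxE {1}/replace eqxx.
    congr (\1__ (_ + _) * _)%:E; apply: eq_bigr => j j0.
    rewrite cofactor_replace// mxE /replace; case: eqVneq => // /ei[_ /eqP].
    by rewrite (negbTE j0).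
  have [c0|c0] := eqVneq c 0.
    apply: integral0_eq => x _; rewrite fE c0.
    by rewrite [X in _ * X]indicE memNset ?mulr0//= => /(_ erefl).
  (* With nonzero slope [c] the only root is [- b / c], and a normal law has no atoms. *)
  transitivity (\int[normal_prob (m (e ord0 ord0)) s]_x (\1_[set (- b / c)] x)%:E)%E.
    apply: eq_integral => x _; rewrite /= fE !indicE [(c \in _)]mem_set; last by move/eqP: c0.
    rewrite mulr1 !in_set1; congr (nat_of_bool _)%:R%:E.
    by rewrite addr_eq0 -[in RHS](inj_eq (mulIf c0)) divfK.
  by rewrite integral_indic// setIT; exact: normal_prob_set1.
apply/eqP; rewrite -measure_le0.
have -> : D = (D `&` ~` C) `|` (D `&` C) by rewrite -setIUr setUC setUv setIT.
have mDC : measurable (D `&` C) by exact: measurableI.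
have mDnC : measurable (D `&` ~` C) by apply: measurableI => //; exact: measurableC.
apply: (@le_trans _ _ (P (D `&` ~` C) + P (D `&` C))%E); first exact: measureU2.
rewrite PDC add0e -PC.
by apply: le_measure; rewrite ?inE//; exact: subIsetr.
Qed.

(* [|\det| / sqrt (\sum_j cofactor i j ^+ 2)] is the distance of row [i] to the
   span of the other rows. *)
Lemma small_det_le k (e : 'I_k -> 'I_k -> I) (i : 'I_k) delta : coord_inj e ->
  0 < delta ->
  (P [set w | \det (coord_mx e (X ^~ w)) ^+ 2 <=
      delta ^+ 2 * \sum_j cofactor (coord_mx e (X ^~ w)) i j ^+ 2]%R
   <= (expR (2^-1) * (delta / s))%:E)%E.
Proof.
case: k e i => [e []//|k] e i ei delta0.
pose W j y := cofactor (coord_mx e y) i j.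
have mW j : measurable_coord (W j) by exact: measurable_coord_cofactor.
have WE j l y x : W j (replace (e i l) y x) = W j y by exact: cofactor_replace.
have ii : injective (e i) by move=> j l /ei[].
have LE y : linear_form (e i) W y = \det (coord_mx e y).
  by rewrite (expand_det_row _ i); apply: eq_bigr => j _; rewrite mxE mulrC.
set S := [set w | _].
pose S1 := [set w | (weight2 W (X ^~ w) != 0) &&
  (linear_form (e i) W (X ^~ w) ^+ 2 <= delta ^+ 2 * weight2 W (X ^~ w))].
pose S2 := [set w | cofactor (coord_mx e (X ^~ w)) i i = 0].
have mS2 : measurable S2 by exact: measurable_cofactor_eq0.
have PS2 : P S2 = 0%E.
  by rewrite /S2 cofactor_eq0; apply: det_eq0_negligible; exact: coord_inj_minor.
have mN := measurable_weight2 mW mX.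
have mL := measurable_linear_form (e i) mW mX.
have mS : measurable S.
  apply: measurable_set_ler.
    by apply: measurable_funX; exact: measurable_coord_det.
  exact: measurable_funM.
have mS1 : measurable S1.
  rewrite [S1](_ : _ = (~` [set w | weight2 W (X ^~ w) = 0]) `&` S).
    by apply: measurableI => //; apply: measurableC; exact: measurable_set_eqr0.
  apply/seteqP; split => w; rewrite /S1 /S /= LE; first by case/andP => /eqP ? ?.
  by case=> /eqP ? ?; apply/andP.
apply: (@le_trans _ _ (P (S1 `|` S2))).
  apply: le_measure; rewrite ?inE//; first exact: measurableU.
  (* If the sum of squared cofactors vanishes, so does the cofactor at [(i, i)]; this case lies in
     the null set [S2]. *)
  move=> w Sw; have [N0|N0] := eqVneq (weight2 W (X ^~ w)) 0; last first.
    by left; rewrite /S1/= N0 LE.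
  right; rewrite /S2/=; apply/eqP; rewrite -sqrf_eq0 eq_le sqr_ge0 andbT -N0.
  by rewrite /weight2 (bigD1 i)//= lerDl sumr_ge0// => j _; exact: sqr_ge0.
apply: (@le_trans _ _ (P S1 + P S2)%E); first exact: measureU2.
rewrite PS2 adde0.
exact: (small_ball_linear_form mX indX ii s0 (fun j => @Xnormal (e i j)) mW WE delta0).
Qed.

End gaussian_matrix.

(** * Bounds on [kappa] *)

(** Markov's inequality, each of the [#|I|] squares having mean at most [6 * s ^+ 2]. *)
Lemma gaussian_sqr_tail (R : realType) d (Omega : measurableType d)
    (P : probability Omega R) (I : finType) (X : I -> Omega -> R) (m : I -> R) (s t : R) :
  (forall k, measurable_fun [set: Omega] (X k)) -> mutually_independent P X ->
  0 < s ->
  (forall k B, measurable B -> P (X k @^-1` B) = normal_prob (m k) s B) ->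
  0 < t ->
  (P [set w | t <= \sum_k (X k w - m k) ^+ 2]%R <= (#|I|%:R * (6 * s ^+ 2) / t)%:E)%E.
Proof.
move=> mX indX s0 Xnormal t0; set S := [set w | _].
have mQ k : measurable_fun [set: Omega] (fun w => (X k w - m k) ^+ 2).
  by apply: measurable_funX; exact: measurable_funB.
have mS : measurable S by apply: measurable_set_ler => //; exact: measurable_sum.
have EQ k : (\int[P]_w ((X k w - m k) ^+ 2)%:E <= (6 * s ^+ 2)%:E)%E.
  pose f y := ((y k - m k) ^+ 2)%:E : \bar R.
  have mf : measurable_coord f.
    move=> d0 T Z mZ; apply/measurable_EFinP; apply: measurable_funX.
    exact: measurable_funB.
  have f0 y : (0 <= f y)%E by rewrite lee_fin sqr_ge0.
  (* Redrawing coordinate [k] in a function of that coordinate alone turns its mean into an integral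
     against the normal law. *)
  have := ge0_integral_replace mX indX (@measurable_idTR R) (@Xnormal k) mf f0.
  rewrite /f => ->.
  have -> : (\int[P]_w \int[normal_prob (m k) s]_x
        ((replace k (X ^~ w) (idfun x) k - m k) ^+ 2)%:E =
      \int[P]_w (cst (\int[normal_prob (m k) s]_x ((x - m k) ^+ 2)%:E) w))%E.
    apply: eq_integral => w _; apply: eq_integral => x _.
    by rewrite /replace eqxx.
  rewrite integral_cst//= probability_setT mule1.
  exact: integral_normal_prob_sqr_le.
have : (t%:E * P S <= \int[P]_w (\sum_k (X k w - m k) ^+ 2)%:E)%E.
  have -> : (t%:E * P S = \int[P]_w (t%:E * (\1_S w)%:E))%E.
    rewrite ge0_integralZl ?lee_fin ?(ltW t0)//; first by rewrite integral_indic// setIT.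
    exact/measurable_EFinP.
  apply: ge0_le_integral => //.
  - by move=> w _; rewrite -EFinM lee_fin mulr_ge0// ltW.
  - by apply/measurable_EFinP/measurable_funM.
  - by apply/measurable_EFinP; exact: measurable_sum.
  - move=> w _; rewrite -EFinM lee_fin indicE.
    have [|wS] := boolP (w \in S); first by rewrite inE mulr1.
    by rewrite mulr0 sumr_ge0// => k _; exact: sqr_ge0.
have -> : (\int[P]_w (\sum_k (X k w - m k) ^+ 2)%:E =
    \sum_k \int[P]_w ((X k w - m k) ^+ 2)%:E)%E.
  rewrite -ge0_integral_sum//; last by move=> k w _; rewrite lee_fin sqr_ge0.
    by apply: eq_integral => w _; rewrite sumEFin.
  by move=> k; exact/measurable_EFinP.
move=> h; rewrite mulrC EFinM -lee_pdivrMl ?invr_gt0// invrK.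
apply: (le_trans h); apply: (@le_trans _ _ (\sum_(k : I) (6 * s ^+ 2)%:E)%E).
  exact: lee_sum.
by rewrite sumEFin lee_fin sumr_const -[leLHS]mulr_natl lexx.
Qed.

Lemma frob2_le_shift (R : realType) m n (A B : 'M[R]_(m, n)) :
  frob2 A <= 2 * frob2 B + 2 * frob2 (A - B).
Proof.
rewrite /frob2 !mulr_sumr -big_split; apply: ler_sum => i _ /=.
rewrite !mulr_sumr -big_split; apply: ler_sum => j _ /=; rewrite !mxE.
(* With [a] and [b] the two entries, [2 * b ^+ 2 + 2 * (a - b) ^+ 2 - a ^+ 2] is the square of
   [a - 2 * b]. *)
by have := sqr_ge0 (A i j - 2 * B i j); lra.
Qed.

Definition left_block (R : realType) r n (hrn : (r <= n)%N) (U : 'M[R]_(r, n)) : 'M[R]_r :=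
  \matrix_(i, j) U i (widen_ord hrn j).

Lemma frob2_mp_pinv_le_left_block (R : realType) r n (hrn : (r <= n)%N) (U : 'M[R]_(r, n)) :
  left_block hrn U \in unitmx ->
  frob2 (mp_pinv U) <= frob2 (invmx (left_block hrn U)).
Proof.
set A := left_block hrn U => uA.
(* [D] pads with zero rows: [D *m invmx A] is a right inverse of [U] with the same Frobenius norm as
   [invmx A]. *)
pose D : 'M[R]_(n, r) := \matrix_(b, a) (b == widen_ord hrn a)%:R.
have DD : D^T *m D = 1%:M.
  apply/matrixP => a c; rewrite !mxE (bigD1 (widen_ord hrn a))//= !mxE eqxx mul1r.
  rewrite big1 ?addr0 => [|b /negbTE ba]; last by rewrite !mxE ba mul0r.
  by [].
have UD : U *m D = A.
  apply/matrixP => a c; rewrite !mxE (bigD1 (widen_ord hrn c))//= !mxE eqxx mulr1.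
  by rewrite big1 ?addr0// => b /negbTE bc; rewrite !mxE bc mulr0.
have -> : frob2 (invmx A) = frob2 (D *m invmx A).
  by rewrite !frob2_tr trmx_mul mulmxA -(mulmxA _ D^T) DD mulmx1.
apply: penrose_frob2_min (mp_pinvP U) _.
by rewrite mulmxA UD mulmxV.
Qed.

Lemma frob2_mp_pinv_le (R : realType) r n (hrn : (r <= n)%N) (U : 'M[R]_(r, n)) delta :
  0 < delta ->
  (forall i, delta ^+ 2 * \sum_j cofactor (left_block hrn U) i j ^+ 2 <
             \det (left_block hrn U) ^+ 2) ->
  frob2 (mp_pinv U) <= r%:R / delta ^+ 2.
Proof.
set A := left_block hrn U => delta0 hA.
have det0 (i : 'I_r) : 0 < \det A ^+ 2.
  apply: le_lt_trans (hA i); rewrite mulr_ge0 ?sqr_ge0// sumr_ge0// => j _.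
  exact: sqr_ge0.
have uA : A \in unitmx.
  (* For [r = 0] the hypothesis is vacuous, but the empty determinant is 1. *)
  rewrite unitmxE unitfE; case: (posnP r) => [r0|r0].
    by move: (A); rewrite r0 => B; rewrite det_mx00 oner_eq0.
  by apply: contraTneq (det0 (Ordinal r0)) => ->; rewrite expr0n ltxx.
apply: (le_trans (frob2_mp_pinv_le_left_block uA)); rewrite frob2_invmx//.
rewrite -[r in r%:R]card_ord mulr_natl -sumr_const; apply: ler_sum => i _.
rewrite ler_pdivrMr ?(det0 i)// mulrC ler_pdivlMr ?exprn_gt0// mulrC.
exact/ltW/hA.
Qed.

(** Used with [t = sqrt n] and [h = sqrt e]. The first term is the union bound over rows, the second
    the tail of the noise. After factoring out [r / t ^+ 2 <= 1] and [t^-1], there remains at most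
    [5 / 7 + 6 / 49 = 41 / 49]. *)
Lemma failure_bound (R : realType) (s t h : R) (r : nat) : 0 < s -> 1 <= t ->
  7 / 5 <= h -> r%:R <= t ^+ 2 ->
  r%:R * (h * (s / (h ^+ 2 * t ^+ 3) / s)) +
  r%:R * t ^+ 2 * (6 * s ^+ 2) / (49 * s ^+ 2 * t ^+ 6) <= t^-1.
Proof.
move=> s0 t1 h1 rt.
have t0 : 0 < t by lra.
have h0 : 0 < h by lra.
have -> : r%:R * (h * (s / (h ^+ 2 * t ^+ 3) / s)) = (r%:R / t ^+ 2) * h^-1 * t^-1.
  by field; rewrite !gt_eqF.
have -> : r%:R * t ^+ 2 * (6 * s ^+ 2) / (49 * s ^+ 2 * t ^+ 6) =
  (r%:R / t ^+ 2) * (6 / 49 * t^-1) * t^-1.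
  by field; rewrite !gt_eqF.
rewrite -mulrDl ler_piMl ?invr_ge0 ?(ltW t0)//.
have ht : h^-1 <= 5 / 7.
  by rewrite -[leRHS]invrK lef_pV2 ?posrE// ?invr_gt0//; lra.
have tV : t^-1 <= 1 by rewrite invf_le1.
have tV0 : 0 < t^-1 by rewrite invr_gt0.
have hV0 : 0 < h^-1 by rewrite invr_gt0.
have rt1 : r%:R / t ^+ 2 <= 1 by rewrite ler_pdivrMr ?exprn_gt0// mul1r.
rewrite -mulrDr mulr_ile1//; last by lra.
  by rewrite divr_ge0 ?sqr_ge0.
by lra.
Qed.

(** Its square is [expR 1 >= 2], whereas [(7 / 5) ^+ 2 = 49 / 25 < 2]. *)
Lemma expR_half_ge (R : realType) : 7 / 5 <= expR (2^-1 : R).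
Proof.
rewrite leNgt; apply/negP => h.
have := expR_ge1Dx (1 : R).
have -> : 1 = 2^-1 + 2^-1 :> R by lra.
rewrite expRD; have := expR_gt0 (2^-1 : R); nra.
Qed.

Lemma kappa_le (R : realType) r n (hrn : (r <= n)%N) (U U' : 'M[R]_(r, n)) s :
  (0 < n)%N -> 0 < s ->
  (forall i, (s / (expR 1 * Num.sqrt n%:R ^+ 3)) ^+ 2 *
     \sum_j cofactor (left_block hrn U) i j ^+ 2 < \det (left_block hrn U) ^+ 2) ->
  frob2 (U - U') <= 49 * s ^+ 2 * n%:R ^+ 3 ->
  kappa U <= 98 * s ^+ 2 * n%:R ^+ 3 + 2 * n%:R * frob2 U' + expR 2 * n%:R ^+ 4 / s ^+ 2.
Proof.
move=> n0 s0 hdet hF.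
set delta := s / _ in hdet.
have nR : 1 <= n%:R :> R by rewrite ler1n.
have t0 : 0 < Num.sqrt n%:R :> R by rewrite sqrtr_gt0; lra.
have delta0 : 0 < delta by rewrite divr_gt0// mulr_gt0 ?expR_gt0// exprn_gt0.
have hP := frob2_mp_pinv_le delta0 hdet.
have hU := frob2_le_shift U U'.
have hU' : frob2 U' <= n%:R * frob2 U' by rewrite ler_peMl ?frob2_ge0.
have rn : r%:R <= n%:R :> R by rewrite ler_nat.
(* Here [delta ^+ 2 = s ^+ 2 / (e ^+ 2 * n ^+ 3)], and [r <= n] supplies the fourth power of [n]. *)
have : r%:R / delta ^+ 2 <= expR 2 * n%:R ^+ 4 / s ^+ 2.
  have -> : expR 2 = expR 1 ^+ 2 :> R by rewrite expr2 -expRD.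
  have -> : delta ^+ 2 = s ^+ 2 / (expR 1 ^+ 2 * n%:R ^+ 3).
    by rewrite /delta expr_div_n exprMn exprAC sqr_sqrtr// ltW// (lt_le_trans ltr01).
  rewrite invf_div mulrA ler_pM2r ?invr_gt0 ?exprn_gt0//.
  rewrite (_ : expR 1 ^+ 2 * n%:R ^+ 4 = n%:R * (expR 1 ^+ 2 * n%:R ^+ 3)); last by ring.
  rewrite ler_pM2r// mulr_gt0 ?exprn_gt0 ?expR_gt0//.
  by rewrite (lt_le_trans ltr01).
by rewrite /kappa; lra.
Qed.

Theorem theorem6p6 (R : realType) (r n : nat) (hrn : (r <= n)%N)
    (U' : 'M[R]_(r, n)) (sigma : R) (hsigma : 0 < sigma)
    (d : measure_display) (Omega : measurableType d) (P : probability Omega R)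
    (X : 'I_r * 'I_n -> Omega -> R)
    (hXmeas : forall ij, measurable_fun [set: Omega] (X ij))
    (hXind : mutually_independent P X)
    (hXgauss : forall ij B, measurable B ->
        P (X ij @^-1` B) = normal_prob (U' ij.1 ij.2) sigma B) :
  let U (w : Omega) : 'M[R]_(r, n) := \matrix_(i, j) X (i, j) w in
  let E := [set w | kappa (U w) <= 98 * sigma ^+ 2 * n%:R ^+ 3 + 2 * n%:R * frob2 U'
                                   + expR 2 * n%:R ^+ 4 / sigma ^+ 2] in
  measurable E /\
  (P E >= (1 - ((Num.sqrt n%:R)^-1 + expR (- (2 * n%:R / pi ^+ 2))))%:E)%E.
Proof.
move=> U E.
have mU : measurable_mx U by move=> i j; under eq_fun do rewrite mxE; exact: hXmeas.
have mE : measurable E by apply: measurable_set_ler => //; exact: measurable_kappa.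
split=> //.
(* For [n = 0] the inverse of [sqrt 0] is 0 and the exponential is 1, so the claimed lower bound is
   0. *)
have [n0|n0] := posnP n.
  apply: (@le_trans _ _ 0%E); last exact: measure_ge0.
  by rewrite lee_fin n0 sqrtr0 invr0 mulr0 mul0r oppr0 expR0 add0r subrr.
set t := Num.sqrt n%:R.
have nR : 1 <= n%:R :> R by rewrite ler1n.
have t1 : 1 <= t by rewrite -sqrtr1 ler_wsqrtr.
have t0 : 0 < t by exact: lt_le_trans t1.
have tn : t ^+ 2 = n%:R by rewrite sqr_sqrtr// ler0n.
pose h : R := expR 2^-1.
have h0 : 0 < h by exact: expR_gt0.
have he : expR 1 = h ^+ 2 by rewrite expr2 -expRD; congr expR; lra.
pose delta := sigma / (expR 1 * t ^+ 3).
have delta0 : 0 < delta by rewrite divr_gt0// mulr_gt0 ?expR_gt0// exprn_gt0.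
pose e (a b : 'I_r) := (a, widen_ord hrn b).
have ei : coord_inj e.
  by move=> a b a' b' [-> bb']; split => //; exact: val_inj.
have eE w : coord_mx e (X ^~ w) = left_block hrn (U w).
  by apply/matrixP => i j; rewrite !mxE.
pose m (ij : 'I_r * 'I_n) := U' ij.1 ij.2.
pose bad i := [set w | \det (coord_mx e (X ^~ w)) ^+ 2 <=
      delta ^+ 2 * \sum_j cofactor (coord_mx e (X ^~ w)) i j ^+ 2].
pose tail := [set w | 49 * sigma ^+ 2 * t ^+ 6 <= \sum_k (X k w - m k) ^+ 2].
have mA : measurable_mx (fun w => coord_mx e (X ^~ w)).
  by move=> i j; under eq_fun do rewrite mxE; exact: hXmeas.
have mbad i : measurable (bad i).
  apply: measurable_set_ler; first by apply: measurable_funX; exact: measurable_det.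
  apply: measurable_funM => //; apply: measurable_sum => j.
  by apply: measurable_funX; exact: measurable_cofactor.
have mtail : measurable tail.
  apply: measurable_set_ler => //; apply: measurable_sum => k.
  by apply: measurable_funX; exact: measurable_funB.
have Pbad i : (P (bad i) <= (h * (delta / sigma))%:E)%E.
  exact: (@small_det_le _ _ _ _ _ _ m).
have t6 : 0 < 49 * sigma ^+ 2 * t ^+ 6 by rewrite !mulr_gt0// exprn_gt0.
have Ptail := gaussian_sqr_tail hXmeas hXind hsigma hXgauss t6.
pose bads := \big[setU/set0]_(i < r) bad i `|` tail.
have mbads : measurable (\big[setU/set0]_(i < r) bad i).
  exact: bigsetU_measurable.
have Pbads : (P bads <= (t^-1)%:E)%E.
  apply: (@le_trans _ _ (P (\big[setU/set0]_(i < r) bad i) + P tail)%E).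
    exact: measureU2.
  apply: (@le_trans _ _ ((r%:R * (h * (delta / sigma)))%:E +
      (r%:R * t ^+ 2 * (6 * sigma ^+ 2) / (49 * sigma ^+ 2 * t ^+ 6))%:E)%E).
    apply: leeD.
      apply: (le_trans (measure_bigsetU_le _ mbad)).
      apply: (@le_trans _ _ (\sum_(i < r) (h * (delta / sigma))%:E)%E).
        by apply: lee_sum => i _; exact: Pbad.
      by rewrite sumEFin lee_fin sumr_const card_ord -[leLHS]mulr_natl.
    by apply: (le_trans Ptail); rewrite card_prod !card_ord natrM tn.
  rewrite -EFinD lee_fin /delta he.
  apply: failure_bound => //; first exact: expR_half_ge.
  by rewrite tn ler_nat.
(* Off the bad events, every row of the left block is far from the span of the others and the noise
   is small, so [kappa_le] applies; [t ^+ 6] is [n ^+ 3]. *)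
have bE : ~` bads `<=` E.
  move=> w; rewrite /bads setCU => -[wb wt].
  apply: (@kappa_le _ _ _ hrn) => //.
    move=> i; rewrite -eE ltNge; apply/negP => wi; apply: wb.
    by rewrite -bigcup_seq; exists i; rewrite //= mem_index_enum.
  have t6E : t ^+ 6 = n%:R ^+ 3 by rewrite -tn -exprM.
  rewrite -t6E leNgt; apply/negP => wF; apply: wt; apply: (le_trans (ltW wF)).
  rewrite /frob2 pair_big/=.
  rewrite le_eqVlt; apply/orP; left; apply/eqP; apply: eq_bigr => -[i j] _.
  by rewrite !mxE.
apply: (@le_trans _ _ (P (~` bads))); last first.
  by apply: le_measure; rewrite ?inE//; apply: measurableC; exact: measurableU.
rewrite probability_setC; last exact: measurableU.
rewrite EFinB; apply: leeB => //.
apply: (le_trans Pbads); rewrite lee_fin lerDl; exact: expR_ge0.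
Qed.
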